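(* Let $A\in M_{n,n}(\mathbb{R})$ and let $\vec{c}\in\{-1,1\}^n$ with $c_1=1$. Then the sum of all principal minors of order two of $A$ equals the sum of all principal minors of order two of $A_S(\vec{c})$ plus the sum of all principal minors of order two of $A_{AS}(\vec{c})$. Similarly, the sum of all principal permanents of order two of $A$ equals the sum of all principal permanents of order two of $A_S(\vec{c})$ plus the sum of all principal permanents of order two of $A_{AS}(\vec{c})$.
   Context: $M_{n,n}(\mathbb{R})$ is the set of real $n\times n$ matrices. For $A=(a_{ij})\in M_{n,n}(\mathbb{R})$ and $\vec{c}=(c_1,\ldots,c_n)\in\{-1,1\}^n$ with $c_1=1$, the matrix $A_S(\vec{c})$ has $(i,j)$ entry $a_{ij}$ if $c_ic_j=1$ and $0$ if $c_ic_j=-1$; the matrix $A_{AS}(\vec{c})$ has $(i,j)$ entry $0$ if $c_ic_j=1$ and $a_{ij}$ if $c_ic_j=-1$. A principal minor (resp. principal permanent) of order two of a matrix is the determinant (resp. permanent) of the $2\times2$ submatrix formed by rows and columns $i,j$, for some $1\le i<j\le n$. *)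

(* Defs.v *)
From mathcomp Require Import all_boot all_order all_algebra all_fingroup.
From mathcomp Require Import reals.

Set Implicit Arguments.
Unset Strict Implicit.
Unset Printing Implicit Defensive.

Import Order.TTheory GRing.Theory Num.Theory.
Local Open Scope ring_scope.

Definition permanent (R : comNzRingType) (m : nat) (B : 'M[R]_m) : R :=
  \sum_(s : 'S_m) \prod_(i < m) B i (s i).

Definition principal_submx2 (R : Type) (n : nat) (i j : 'I_n) (A : 'M[R]_n) :
    'M[R]_2 :=
  mxsub (tnth [tuple i; j]) (tnth [tuple i; j]) A.

Definition sum_principal_minors2 (R : comNzRingType) (n : nat) (A : 'M[R]_n) :
    R :=
  \sum_(i < n) \sum_(j < n | (i < j)%N) \det (principal_submx2 i j A).

Definition sum_principal_permanents2 (R : comNzRingType) (n : nat)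
    (A : 'M[R]_n) : R :=
  \sum_(i < n) \sum_(j < n | (i < j)%N) permanent (principal_submx2 i j A).

(* Both matrices below are meant for c with entries in {-1, 1}, where each
   product c_i c_j is either 1 or -1. *)
Definition A_S (R : realType) (n : nat) (A : 'M[R]_n) (c : 'rV[R]_n) :
    'M[R]_n :=
  \matrix_(i < n, j < n) if c 0 i * c 0 j == 1 then A i j else 0.

Definition A_AS (R : realType) (n : nat) (A : 'M[R]_n) (c : 'rV[R]_n) :
    'M[R]_n :=
  \matrix_(i < n, j < n) if c 0 i * c 0 j == -1 then A i j else 0.

(* Main.v *)
(** Each order-two principal minor or permanent is [a_ii a_jj -/+ a_ij a_ji].
    Since [c_i c_i = 1] the whole diagonal goes to [A_S], and since
    [c_i c_j = c_j c_i] the factors [a_ij] and [a_ji] go to the same one of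
    [A_S] and [A_AS]. *)
Require Import Defs.
From mathcomp Require Import all_boot all_order all_algebra all_fingroup.
From mathcomp Require Import reals.
From mathcomp Require Import ring.

Set Implicit Arguments.
Unset Strict Implicit.
Unset Printing Implicit Defensive.

Import Order.TTheory GRing.Theory Num.Theory.
Local Open Scope ring_scope.

(** Injectivity rules out two of the four possible pairs of values at [ord0] and [ord_max]; the
    other two pairs are those of the identity and the swap. *)
Lemma perm2P (s : 'S_2) : s = 1%g \/ s = tperm ord0 ord_max.
Proof.
have ord2P (i : 'I_2) : i = ord0 \/ i = ord_max.
  by case: i => [[|[|//]] i_lt]; [left|right]; apply: val_inj.
have s_inj : s ord0 != s ord_max by rewrite (inj_eq perm_inj).
case: (ord2P (s ord0)) (ord2P (s ord_max)) s_inj => s0 [] s1;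
  rewrite s0 s1 ?eqxx // => _; [left|right]; apply/permP => i;
  by case: (ord2P i) => ->; rewrite ?perm1 ?tpermL ?tpermR.
Qed.

(** Serves to expand the permutation sums of both [permanent] and [\det]. *)
Lemma sum_perm2 (V : nmodType) (F : 'S_2 -> V) :
  \sum_(s : 'S_2) F s = F 1%g + F (tperm ord0 ord_max).
Proof.
have neq_perm : tperm ord0 ord_max != 1%g :> 'S_2.
  by apply/eqP => /permP/(_ ord0); rewrite tpermL perm1.
rewrite (bigD1 1%g) //= (bigD1 (tperm ord0 ord_max)) //= big_pred0 ?addr0 //.
by move=> s; case: (perm2P s) => ->; rewrite eqxx ?andbF.
Qed.

Lemma prod_ord2 (R : comNzRingType) (F : 'I_2 -> R) :
  \prod_(i < 2) F i = F ord0 * F ord_max.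
Proof.
(* The first index comes out as a widened element of ['I_1], which agrees with [ord0] in value. *)
by rewrite big_ord_recr big_ord1; congr (F _ * _); apply: val_inj.
Qed.

Lemma permanent_mx22 (R : comNzRingType) (B : 'M[R]_2) :
  permanent B = B ord0 ord0 * B ord_max ord_max
                + B ord0 ord_max * B ord_max ord0.
Proof. by rewrite /permanent sum_perm2 !prod_ord2 !perm1 tpermL tpermR. Qed.

Lemma det_mx22 (R : comNzRingType) (B : 'M[R]_2) :
  \det B = B ord0 ord0 * B ord_max ord_max
           - B ord0 ord_max * B ord_max ord0.
Proof.
rewrite /determinant sum_perm2 !prod_ord2 !perm1 tpermL tpermR.
by rewrite odd_perm1 odd_tperm mul1r mulN1r.
Qed.

Lemma permanent_principal_submx2 (R : comNzRingType) (n : nat) (i j : 'I_n)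
    (A : 'M[R]_n) :
  permanent (principal_submx2 i j A) = A i i * A j j + A i j * A j i.
Proof. by rewrite permanent_mx22 !mxE. Qed.

Lemma det_principal_submx2 (R : comNzRingType) (n : nat) (i j : 'I_n)
    (A : 'M[R]_n) :
  \det (principal_submx2 i j A) = A i i * A j j - A i j * A j i.
Proof. by rewrite det_mx22 !mxE. Qed.

Theorem theorem9 (R : realType) (n : nat) (n_gt0 : (0 < n)%N)
    (A : 'M[R]_n) (c : 'rV[R]_n)
    (c_sign : forall i : 'I_n, c 0 i = -1 \/ c 0 i = 1)
    (c_first : c 0 (Ordinal n_gt0) = 1) :
  sum_principal_minors2 A =
    sum_principal_minors2 (A_S A c) + sum_principal_minors2 (A_AS A c)
  /\
  sum_principal_permanents2 A =
    sum_principal_permanents2 (A_S A c) + sum_principal_permanents2 (A_AS A c).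
Proof.
have sqr_sign i : c 0 i * c 0 i = 1.
  by case: (c_sign i) => ->; rewrite ?mulrNN mulr1.
(* Makes the tests defining [A_S] and [A_AS] mutually exclusive. *)
have neq1N1 : (1 == -1 :> R) = false by rewrite eq_sym eqNr oner_eq0.
have diag_S i : A_S A c i i = A i i by rewrite mxE sqr_sign eqxx.
have diag_AS i : A_AS A c i i = 0 by rewrite mxE sqr_sign neq1N1.
have off_diag i j :
  A i j * A j i = A_S A c i j * A_S A c j i + A_AS A c i j * A_AS A c j i.
  (* After commuting, the entries at [(i, j)] and [(j, i)] test the same product, so one case split
     settles both. *)
  rewrite !mxE (mulrC (c 0 j)).
  have [->|->] : c 0 i * c 0 j = 1 \/ c 0 i * c 0 j = -1.
    by case: (c_sign i) => ->; case: (c_sign j) => ->;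
      rewrite ?mulrNN ?mulr1 ?mul1r; [left|right|right|left].
  - by rewrite eqxx neq1N1 mul0r addr0.
  - by rewrite eqxx eq_sym neq1N1 mul0r add0r.
(* Both identities hold separately for each pair [i < j]. *)
split; rewrite -big_split; apply: eq_bigr => i _;
  rewrite -big_split; apply: eq_bigr => j _.
- by rewrite /= !det_principal_submx2 !diag_S !diag_AS off_diag; ring.
- by rewrite /= !permanent_principal_submx2 !diag_S !diag_AS off_diag; ring.
Qed.
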